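(* Let $\mathfrak{aff}(\mathbb{R})$ be the $2$-dimensional non-abelian real Lie algebra, let $\nabla$ be a flat torsion-free connection on $\mathfrak{aff}(\mathbb{R})$ and $\omega$ a symplectic form on $\mathfrak{aff}(\mathbb{R})$ with $\nabla\omega=0$. Then $(\nabla,\omega)$ is symplectically equivalent to either $(\nabla^1,e^1\wedge e^2)$ or $(\nabla^2,e^1\wedge e^2)$, where $\{e_1,e_2\}$ is a suitable basis of $\mathfrak{aff}(\mathbb{R})$, $\{e^1,e^2\}$ is the dual basis and $\nabla^1,\nabla^2$ are given by $$\nabla^1_{e_1}e_1=-e_1,\quad \nabla^1_{e_1}e_2=e_2,\quad \nabla^1_{e_2}\equiv 0$$ and $$\nabla^2_{e_1}e_1=-\tfrac12 e_1,\quad \nabla^2_{e_1}e_2=\tfrac12 e_2,\quad \nabla^2_{e_2}e_1=-\tfrac12 e_2,\quad \nabla^2_{e_2}e_2=0.$$ Both connections $\nabla^1$ and $\nabla^2$ on $\mathfrak{aff}(\mathbb{R})$ are not complete.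
   Context: The Lie algebra $\mathfrak{aff}(\mathbb R)$ has a basis $\{e_1,e_2\}$ with $[e_1,e_2]=e_2$. A connection on a real Lie algebra $\mathfrak h$ is a bilinear map $\nabla:\mathfrak h\times\mathfrak h\to\mathfrak h$, $(x,y)\mapsto\nabla_xy$; it is torsion-free if $\nabla_xy-\nabla_yx=[x,y]$ and flat if $\nabla_x\nabla_y-\nabla_y\nabla_x=\nabla_{[x,y]}$ for all $x,y$. A symplectic form is a nondegenerate 2-form $\omega$ that is closed, i.e. $-\omega([x,y],z)+\omega([x,z],y)-\omega([y,z],x)=0$ for all $x,y,z$ (automatic in dimension 2). $\nabla\omega=0$ means $\omega(\nabla_xy,z)=\omega(\nabla_xz,y)$ for all $x,y,z\in\mathfrak h$. Pairs $(\nabla,\omega)$ on $\mathfrak h$ and $(\nabla',\omega')$ on $\mathfrak h'$ (each consisting of a connection and a symplectic form parallel for it) are symplectically equivalent if there is a Lie algebra isomorphism $\xi:\mathfrak h\to\mathfrak h'$ with $\xi\nabla_xy=\nabla'_{\xi x}\xi y$ and $\omega(x,y)=\omega'(\xi x,\xi y)$ for all $x,y\in\mathfrak h$. A connection $\nabla$ on $\mathfrak h$ is complete if all solutions $x(t)\in\mathfrak h$ of the differential equation $\dot x(t)=-\nabla_{x(t)}x(t)$ are defined for all $t\in\mathbb R$ (this is equivalent to geodesic completeness of the corresponding left-invariant connection on a Lie group with Lie algebra $\mathfrak h$). *)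

(* Defs.v *)
From HB Require Import structures.
From mathcomp Require Import all_boot all_order all_algebra.
From mathcomp Require Import all_classical all_reals all_analysis.
From mathcomp Require Import ring.
Import Order.TTheory GRing.Theory Num.Theory.
Import passmx.
Import numFieldNormedType.Exports.

Set Implicit Arguments.
Unset Strict Implicit.
Unset Printing Implicit Defensive.

Local Open Scope classical_set_scope.
Local Open Scope ring_scope.

HB.mixin Record Vector_isLieAlgebra (R : fieldType) (V : Type) of Vector R V := {
  lie : V -> V -> V;
  lie_bilinear : bilinear_for *:%R *:%R lie;
  liexx : forall x, lie x x = 0;
  lie_jacobi : forall x y z,
    lie x (lie y z) + lie y (lie z x) + lie z (lie x y) = 0
}.

#[short(type="lieAlgType")]
HB.structure Definition LieAlgebra (R : fieldType) :=
  { V of Vector R V & Vector_isLieAlgebra R V }.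

Section Connections.
Variables (R : realType) (h : lieAlgType R).
Implicit Types (nabla : {bilinear h -> h -> h}) (omega : {biscalar h}).

Definition torsion_free nabla : Prop :=
  forall x y : h, nabla x y - nabla y x = lie x y.

Definition flat nabla : Prop :=
  forall x y z : h,
    nabla x (nabla y z) - nabla y (nabla x z) = nabla (lie x y) z.

Definition alternating omega : Prop := forall x : h, omega x x = 0.

Definition nondegenerate_form omega : Prop :=
  forall x : h, (forall y : h, omega x y = 0) -> x = 0.

Definition closed_form omega : Prop :=
  forall x y z : h,
    - omega (lie x y) z + omega (lie x z) y - omega (lie y z) x = 0.

Definition symplectic_form omega : Prop :=
  [/\ alternating omega, nondegenerate_form omega & closed_form omega].

Definition parallel nabla omega : Prop :=
  forall x y z : h, omega (nabla x y) z = omega (nabla x z) y.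

(* The derivative is taken in the normed space of coordinate row vectors with
   respect to a basis of [h]; it does not depend on the choice of the basis. *)
Definition solution_on (I : set R) nabla (x : R -> h) : Prop :=
  forall t, I t ->
    is_derive t (1 : R) (fun s : R => rVof (vbasis {:h}) (x s))
      (rVof (vbasis {:h}) (- nabla (x t) (x t))).

(* "All solutions are defined for all t": every solution on an open interval
   extends to a solution on the whole line (the values of [x] outside [I] are
   irrelevant). *)
Definition complete_connection nabla : Prop :=
  forall (I : set R) (x : R -> h),
    open I -> is_interval I -> solution_on I nabla x ->
    exists y : R -> h,
      solution_on [set: R] nabla y /\ (forall t, I t -> y t = x t).

End Connections.

Definition sympl_equiv (R : realType) (h h' : lieAlgType R)
    (nabla : {bilinear h -> h -> h}) (omega : {biscalar h})
    (nabla' : {bilinear h' -> h' -> h'}) (omega' : {biscalar h'}) : Prop :=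
  exists xi : {linear h -> h'},
    [/\ bijective xi,
        forall x y, xi (lie x y) = lie (xi x) (xi y),
        forall x y, xi (nabla x y) = nabla' (xi x) (xi y) &
        forall x y, omega x y = omega' (xi x) (xi y)].

Section Models.
Variables (R : realType) (h : lieAlgType R) (e1 e2 : h).

Definition aff_basis : Prop :=
  basis_of {:h} [:: e1; e2] /\ lie e1 e2 = e2.

Definition dual1 (x : h) : R := coord [tuple e1; e2] 0 x.
Definition dual2 (x : h) : R := coord [tuple e1; e2] 1 x.

Definition wedge12 (x y : h) : R := dual1 x * dual2 y - dual2 x * dual1 y.

(* The connection with nabla_{e_i} e_j = c_ij. *)
Definition conn_table (c11 c12 c21 c22 : h) (x y : h) : h :=
  (dual1 x * dual1 y) *: c11 + (dual1 x * dual2 y) *: c12 +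
  (dual2 x * dual1 y) *: c21 + (dual2 x * dual2 y) *: c22.

Fact dual1P a x y : dual1 (a *: x + y) = a * dual1 x + dual1 y.
Proof. exact: linearP. Qed.

Fact dual2P a x y : dual2 (a *: x + y) = a * dual2 x + dual2 y.
Proof. exact: linearP. Qed.

Fact wedge12_bilinear : bilinear_for *%R *%R wedge12.
Proof. by split=> u a x y; rewrite /wedge12 !(dual1P, dual2P) /=; ring. Qed.

HB.instance Definition _ :=
  bilinear_isBilinear.Build R h h R *%R *%R wedge12 wedge12_bilinear.

Fact conn_table_bilinear c11 c12 c21 c22 :
  bilinear_for *:%R *:%R (conn_table c11 c12 c21 c22).
Proof.
split=> u a x y; rewrite /conn_table !(dual1P, dual2P) /=.
  rewrite !mulrDl !scalerDl -!mulrA -!(scalerA a).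
  by rewrite [LHS](AC (2*2*2*2) ((1*3*5*7)*(2*4*6*8))) !(scalerDr a).
rewrite !mulrDr !(mulrCA _ a) !scalerDl -!(scalerA a).
by rewrite [LHS](AC (2*2*2*2) ((1*3*5*7)*(2*4*6*8))) !(scalerDr a).
Qed.

HB.instance Definition _ c11 c12 c21 c22 :=
  bilinear_isBilinear.Build R h h h *:%R *:%R (conn_table c11 c12 c21 c22)
    (conn_table_bilinear c11 c12 c21 c22).

Definition nabla1 : {bilinear h -> h -> h} := conn_table (- e1) e2 0 0.

Definition nabla2 : {bilinear h -> h -> h} :=
  conn_table (- (2^-1 *: e1)) (2^-1 *: e2) (- (2^-1 *: e2)) 0.

End Models.

(* Main.v *)
Require Import Defs.
From HB Require Import structures.
From mathcomp Require Import all_boot all_order all_algebra.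
From mathcomp Require Import all_classical all_reals all_analysis.
From mathcomp Require Import ring lra.
Import Order.TTheory GRing.Theory Num.Theory.
Import passmx numFieldNormedType.Exports.

(** Why the classification holds. In a basis with [lie e1 e2 = e2], put
    A = nabla e1 and B = nabla e2. In dimension two a parallel symplectic form
    says exactly that every [nabla x] has trace zero ([parallel_traceless]), so
    A and B lie in sl(2), and flatness says [A, B] = B. Hence
    tr (B^2) = tr (B [A, B]) = 0, so B is nilpotent; together with the
    vanishing of torsion, A e2 - B e1 = e2, this forces B e2 = 0,
    B e1 = (-1 - a) e2, A e2 = - a e2 and A e1 = a e1 + c e2 with
    (a + 1) (a + 1/2) = 0 ([sl2_bracket_scalars], [flat_parallel_coords]).
    The two roots a give the two models. What is left is to remove c and to
    normalise the form, and the bases with the same bracket relation leave just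
    enough freedom for that: e1 may be replaced by e1 + s e2, which moves c by
    - (1 + 3 a) s with 1 + 3 a nonzero for both roots, and e2 by any nonzero
    multiple, which scales [omega e1 e2] to 1 ([flat_parallel_normal_form]). The
    linear map matching two such bases is a Lie algebra automorphism
    ([sympl_equiv_of_table]).

    Why the models are incomplete. Both satisfy nabla e1 e1 = mu e1 with mu
    nonzero, so the line of e1 is invariant under the equation, which reduces
    there to u' = - mu u^2. Its solution u(t) = 1 / (mu t) on the negative
    half-line blows up at 0 ([incomplete_of_eigenray]). *)

Set Implicit Arguments.
Unset Strict Implicit.
Unset Printing Implicit Defensive.

Local Open Scope classical_set_scope.
Local Open Scope ring_scope.

(** * Bases of the nonabelian two-dimensional Lie algebra *)

Section LieBilinear.
Variables (R : fieldType) (h : lieAlgType R).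

HB.instance Definition _ :=
  bilinear_isBilinear.Build R h h h *:%R *:%R (@lie R h) (@lie_bilinear R h).

Lemma lie_anticomm (x y : h) : lie y x = - lie x y.
Proof.
have := liexx (x + y).
rewrite linearDr /= !linearDl /= !liexx add0r addr0 => /eqP.
by rewrite addr_eq0 => /eqP.
Qed.

End LieBilinear.

Section Basis.
Variables (R : realType) (h : lieAlgType R).
Hypothesis h_dim2 : \dim {:h} = 2%N.

(** If e1 were a multiple of e2, the bracket of e1 and e2 would vanish. *)
Lemma aff_basis_intro (e1 e2 : h) :
  e2 != 0 -> lie e1 e2 = e2 -> aff_basis e1 e2.
Proof.
move=> e2_neq0 e12; split=> //.
rewrite basisEfree subvf /= h_dim2 andbT free_cons seq1_free e2_neq0 andbT.
rewrite span_seq1; apply/vlineP => -[k e1E].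
by move: e2_neq0; rewrite -e12 e1E linearZl_LR /= liexx scaler0 eqxx.
Qed.

(** The derived algebra is a line, spanned by some w = [x, y] = a x + b y. Then
    [x, w] = b w and [y, w] = - a w, so one of x and y, rescaled, acts on w with
    eigenvalue one. *)
Lemma aff_basis_exists :
  ~ (forall x y : h, lie x y = 0) -> exists e1 e2 : h, aff_basis e1 e2.
Proof.
move=> h_nonabelian.
have [x [y xy_neq0]] : exists x y : h, lie x y != 0.
  apply/not_existsP => none; apply: h_nonabelian => x y.
  by apply/eqP; apply: contra_notT (none x) => ?; exists y.
have xy_basis : basis_of {:h} [tuple x; y].
  rewrite basisEfree subvf /= h_dim2 andbT free_cons seq1_free span_seq1.
  apply/andP; split; last by apply: contra_neq xy_neq0 => ->; rewrite linear0r.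
  apply/vlineP => -[k xE].
  by move: xy_neq0; rewrite xE linearZl_LR /= liexx scaler0 eqxx.
have := coord_basis xy_basis (memvf (lie x y)).
rewrite !big_ord_recl big_ord0 addr0 /=.
set a := coord _ _ _; set b := coord _ _ _ => xyE.
have xz : lie x (lie x y) = b *: lie x y.
  by rewrite [in LHS]xyE linearDr /= !linearZr_LR /= liexx scaler0 add0r.
have yz : lie y (lie x y) = - a *: lie x y.
  rewrite [in LHS]xyE linearDr /= !linearZr_LR /= liexx scaler0 addr0.
  by rewrite lie_anticomm scalerN scaleNr.
have [b_eq0|b_neq0] := eqVneq b 0.
  have a_neq0 : a != 0.
    apply: contra_neq xy_neq0 => a_eq0.
    by rewrite xyE a_eq0 b_eq0 !scale0r addr0.
  exists ((- a)^-1 *: y), (lie x y); apply: aff_basis_intro => //.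
  by rewrite linearZl_LR /= yz scalerA mulVf ?scale1r // oppr_eq0.
exists (b^-1 *: x), (lie x y); apply: aff_basis_intro => //.
by rewrite linearZl_LR /= xz scalerA mulVf ?scale1r.
Qed.

End Basis.

(** * Coordinates in an adapted basis *)

Section Coordinates.
Variables (R : realType) (h : lieAlgType R) (e1 e2 : h).
Hypothesis e_aff : aff_basis e1 e2.

Lemma aff_basis_decomp v : v = dual1 e1 e2 v *: e1 + dual2 e1 e2 v *: e2.
Proof.
have e_basis : basis_of {:h} [tuple e1; e2] by case: e_aff.
rewrite {1}(coord_basis e_basis (memvf v)).
rewrite !big_ord_recl big_ord0 addr0; congr (_ + coord _ _ _ *: _).
exact: val_inj.
Qed.

Lemma dual1_comb a b : dual1 e1 e2 (a *: e1 + b *: e2) = a.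
Proof.
have [/basis_free e_free _] := e_aff.
rewrite /dual1 linearD /= !linearZ /=.
rewrite (coord_free (X := [tuple e1; e2]) 0 0 e_free).
by rewrite (coord_free (X := [tuple e1; e2]) 1 0 e_free) mulr1 mulr0 addr0.
Qed.

Lemma dual2_comb a b : dual2 e1 e2 (a *: e1 + b *: e2) = b.
Proof.
have [/basis_free e_free _] := e_aff.
rewrite /dual2 linearD /= !linearZ /=.
rewrite (coord_free (X := [tuple e1; e2]) 0 1 e_free).
by rewrite (coord_free (X := [tuple e1; e2]) 1 1 e_free) mulr1 mulr0 add0r.
Qed.

Lemma dual1_e1 : dual1 e1 e2 e1 = 1.
Proof. by have := dual1_comb 1 0; rewrite scale1r scale0r addr0. Qed.

Lemma dual1_e2 : dual1 e1 e2 e2 = 0.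
Proof. by have := dual1_comb 0 1; rewrite scale1r scale0r add0r. Qed.

Lemma dual2_e1 : dual2 e1 e2 e1 = 0.
Proof. by have := dual2_comb 1 0; rewrite scale1r scale0r addr0. Qed.

Lemma dual2_e2 : dual2 e1 e2 e2 = 1.
Proof. by have := dual2_comb 0 1; rewrite scale1r scale0r add0r. Qed.

Definition dual_basisE := (dual1_e1, dual1_e2, dual2_e1, dual2_e2).

Lemma aff_e1_neq0 : e1 != 0.
Proof.
apply/eqP => e1_eq0; have := dual1_e1.
rewrite /dual1 [in X in coord _ _ X]e1_eq0 linear0 => /esym/eqP.
by rewrite oner_eq0.
Qed.

Lemma aff_e2_neq0 : e2 != 0.
Proof.
apply/eqP => e2_eq0; have := dual2_e2.
rewrite /dual2 [in X in coord _ _ X]e2_eq0 linear0 => /esym/eqP.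
by rewrite oner_eq0.
Qed.

Lemma aff_basis_inj a b c d :
  a *: e1 + b *: e2 = c *: e1 + d *: e2 -> a = c /\ b = d.
Proof.
move=> E; split; first by rewrite -(dual1_comb a b) E dual1_comb.
by rewrite -(dual2_comb a b) E dual2_comb.
Qed.

Lemma bilinear_expand (f : {bilinear h -> h -> h}) x y :
  f x y = conn_table e1 e2 (f e1 e1) (f e1 e2) (f e2 e1) (f e2 e2) x y.
Proof.
rewrite {1}[x]aff_basis_decomp {1}[y]aff_basis_decomp /conn_table.
rewrite linearDl /= !linearDr /= !linearZl_LR /= !linearZr_LR /= !scalerA.
by rewrite !addrA.
Qed.

(** The bracket and every alternating form are multiples of the same 2-form.
    A linear map matching adapted bases preserves that 2-form, hence it
    respects the bracket and, once [omega e1 e2] is normalised, the form. *)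
Lemma lie_wedge x y : lie x y = wedge12 e1 e2 x y *: e2.
Proof.
have [_ e12] := e_aff.
rewrite (bilinear_expand (@lie R h)) /conn_table /= !liexx e12 lie_anticomm e12.
by rewrite !scaler0 add0r addr0 scalerN -scalerBl.
Qed.

Lemma alternating_wedge (omega : {biscalar h}) : Defs.alternating omega ->
  forall x y, omega x y = omega e1 e2 * wedge12 e1 e2 x y.
Proof.
move=> alt x y.
have e21 : omega e2 e1 = - omega e1 e2.
  have := alt (e1 + e2).
  rewrite linearDr /= !linearDl /= !alt add0r addr0 => /eqP.
  by rewrite addr_eq0 => /eqP.
rewrite {1}[x]aff_basis_decomp {1}[y]aff_basis_decomp.
rewrite linearDl /= !linearDr /= !linearZl_LR /= !linearZr_LR /= !alt e21.
rewrite /wedge12 /=.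
have scaleE (a b : R) : a *: (b : R^o) = a * b by [].
rewrite !scaleE; ring.
Qed.

End Coordinates.

(** * Symplectic equivalence from matching multiplication tables *)

Section ChangeOfBasis.
Variables (R : realType) (h : lieAlgType R).
Variables f1 f2 e1 e2 : h.

Definition basis_map (v : h) : h :=
  dual1 f1 f2 v *: e1 + dual2 f1 f2 v *: e2.

Fact basis_map_linear : linear basis_map.
Proof.
move=> a x y; rewrite /basis_map !(dual1P, dual2P) !scalerDl scalerDr !scalerA.
by rewrite addrACA.
Qed.

HB.instance Definition _ :=
  GRing.isLinear.Build R h h *:%R basis_map basis_map_linear.

End ChangeOfBasis.

Lemma basis_mapK (R : realType) (h : lieAlgType R) (f1 f2 e1 e2 : h) :
  aff_basis f1 f2 -> aff_basis e1 e2 ->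
  cancel (basis_map f1 f2 e1 e2) (basis_map e1 e2 f1 f2).
Proof.
move=> f_aff e_aff v; rewrite [LHS]/basis_map dual1_comb // dual2_comb //.
by rewrite -aff_basis_decomp.
Qed.

Section AdaptedBasis.
Variables (R : realType) (h : lieAlgType R).
Variables f1 f2 e1 e2 : h.
Hypotheses (f_aff : aff_basis f1 f2) (e_aff : aff_basis e1 e2).

Local Notation xi := (basis_map f1 f2 e1 e2).

Lemma dual1_basis_map v : dual1 e1 e2 (xi v) = dual1 f1 f2 v.
Proof. exact: dual1_comb. Qed.

Lemma dual2_basis_map v : dual2 e1 e2 (xi v) = dual2 f1 f2 v.
Proof. exact: dual2_comb. Qed.

Lemma basis_map_comb a b : xi (a *: f1 + b *: f2) = a *: e1 + b *: e2.
Proof. by rewrite /basis_map dual1_comb // dual2_comb. Qed.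

Lemma basis_map1 : xi f1 = e1.
Proof.
by have := basis_map_comb 1 0; rewrite !scale0r !addr0 !scale1r.
Qed.

Lemma basis_map2 : xi f2 = e2.
Proof.
by have := basis_map_comb 0 1; rewrite !scale0r !add0r !scale1r.
Qed.

Lemma basis_map_wedge x y :
  wedge12 e1 e2 (xi x) (xi y) = wedge12 f1 f2 x y.
Proof. by rewrite /wedge12 !dual1_basis_map !dual2_basis_map. Qed.

Lemma basis_map_conn_table c11 c12 c21 c22 x y :
  xi (conn_table f1 f2 c11 c12 c21 c22 x y) =
  conn_table e1 e2 (xi c11) (xi c12) (xi c21) (xi c22) (xi x) (xi y).
Proof.
rewrite /conn_table !dual1_basis_map !dual2_basis_map.
by rewrite ![in LHS]linearD ![in LHS]linearZ.
Qed.

(** The map sending one adapted basis to the other is automatically a Lie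
    algebra automorphism, so only the four values of each connection and the
    single value of the form have to be compared. *)
Lemma sympl_equiv_of_table (nabla nabla' : {bilinear h -> h -> h})
    (omega : {biscalar h}) :
  Defs.alternating omega -> omega f1 f2 = 1 ->
  nabla' e1 e1 = xi (nabla f1 f1) -> nabla' e1 e2 = xi (nabla f1 f2) ->
  nabla' e2 e1 = xi (nabla f2 f1) -> nabla' e2 e2 = xi (nabla f2 f2) ->
  sympl_equiv nabla omega nabla' (wedge12 e1 e2).
Proof.
move=> alt omega12 E11 E12 E21 E22; exists xi; split.
- by exists (basis_map e1 e2 f1 f2); apply: basis_mapK.
- move=> x y; rewrite (lie_wedge f_aff) (lie_wedge e_aff) basis_map_wedge.
  by rewrite linearZ /= basis_map2.
- move=> x y; rewrite (bilinear_expand f_aff nabla).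
  rewrite (bilinear_expand e_aff nabla').
  rewrite /= E11 E12 E21 E22.
  exact: basis_map_conn_table.
- move=> x y; rewrite (alternating_wedge f_aff) // omega12 mul1r.
  by rewrite /= basis_map_wedge.
Qed.

End AdaptedBasis.

(** * The classification *)

(** The entries of [A, B] = B for A = (a, p; c, - a) and B = (p, q; r, - p),
    where the shared entry p and the relation between a and r express that the
    torsion vanishes. Nilpotency of B makes p^2 + q r = 0; substituting it in
    the equation for q leaves 3 q = 0, whence p = 0. *)
Lemma sl2_bracket_scalars (R : realFieldType) (a c p q r : R) :
  - a - r = 1 ->
  p * a + r * p - (a * p + c * q) = p ->
  p * c + r * - a - (a * r + c * - p) = r ->
  q * a + - p * p - (p * p + - a * q) = q ->
  [/\ p = 0, q = 0 & a = -1 \/ a = - 2^-1].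
Proof.
move=> rE F11 F21 F12; have {}rE : r = - 1 - a by lra.
(* det B = 0, from half the trace of B [A, B] = B^2. *)
have det0 : p ^+ 2 + q * r = 0.
  have : p * (p * a + r * p - (a * p + c * q)) + 2^-1 *
      (r * (q * a + - p * p - (p * p + - a * q)) +
       q * (p * c + r * - a - (a * r + c * - p))) = 0 by field.
  by rewrite F11 F12 F21 => <-; field.
have q0 : q = 0.
  suff : 3 * q = 0 by move/eqP; rewrite mulf_eq0 pnatr_eq0 => /eqP.
  have -> : 3 * q = (q - (q * a + - p * p - (p * p + - a * q)))
                    - 2 * (p ^+ 2 + q * r) by rewrite rE; ring.
  by rewrite F12 det0; ring.
have p0 : p = 0.
  by move/eqP: det0; rewrite q0 mul0r addr0 expf_eq0 /= => /eqP.
split=> //.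
have /eqP : (a + 1) * (a + 2^-1) = 0.
  move: F21; rewrite p0 rE => F21.
  have -> : (a + 1) * (a + 2^-1) = 2^-1 * ((0 * c + (-1 - a) * - a -
     (a * (-1 - a) + c * - 0)) - (-1 - a)) by field.
  by rewrite F21 subrr mulr0.
by rewrite mulf_eq0 !addr_eq0 => /orP[] /eqP; [left|right].
Qed.

Section Classification.
Variables (R : realType) (h : lieAlgType R).
Hypothesis h_dim2 : \dim {:h} = 2%N.
Variables e1 e2 : h.
Hypothesis e_aff : aff_basis e1 e2.
Variables (nabla : {bilinear h -> h -> h}) (omega : {biscalar h}).
Hypotheses (nabla_flat : flat nabla) (nabla_tf : torsion_free nabla).
Hypotheses (omega_sympl : symplectic_form omega).
Hypothesis (omega_par : parallel nabla omega).

Lemma symplectic_neq0 : omega e1 e2 != 0.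
Proof.
have [alt nondeg _] := omega_sympl.
apply: contra_neq (aff_e1_neq0 e_aff) => omega12; apply: nondeg => y.
by rewrite (alternating_wedge e_aff alt) omega12 mul0r.
Qed.

(** Being skew for [omega] at the pair (e1, e2) is the vanishing of the trace,
    since sp(2) = sl(2). *)
Lemma parallel_traceless x :
  dual2 e1 e2 (nabla x e2) = - dual1 e1 e2 (nabla x e1).
Proof.
have [alt _ _] := omega_sympl.
have := omega_par x e1 e2.
rewrite (alternating_wedge e_aff alt (nabla x e1)).
rewrite (alternating_wedge e_aff alt (nabla x e2)) => /(mulfI symplectic_neq0).
rewrite /wedge12 !(dual_basisE e_aff) => E; ring: E.
Qed.


Lemma flat_parallel_coords :
  exists a c : R,
    [/\ (a = -1) \/ (a = - 2^-1),
        nabla e1 e1 = a *: e1 + c *: e2, nabla e1 e2 = - a *: e2,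
        nabla e2 e1 = (- 1 - a) *: e2 & nabla e2 e2 = 0].
Proof.
have N11 := aff_basis_decomp e_aff (nabla e1 e1).
have N12 := aff_basis_decomp e_aff (nabla e1 e2).
have N21 := aff_basis_decomp e_aff (nabla e2 e1).
have N22 := aff_basis_decomp e_aff (nabla e2 e2).
move: N11 N12 N21 N22; rewrite !parallel_traceless.
set a := dual1 _ _ (nabla e1 e1); set c := dual2 _ _ (nabla e1 e1).
set b := dual1 _ _ (nabla e1 e2).
set p := dual1 _ _ (nabla e2 e1); set r := dual2 _ _ (nabla e2 e1).
set q := dual1 _ _ (nabla e2 e2) => N11 N12 N21 N22.
have [_ e12] := e_aff.
have fl1 := nabla_flat e1 e2 e1; have fl2 := nabla_flat e1 e2 e2.
have comb x u v :
    nabla x (u *: e1 + v *: e2) = u *: nabla x e1 + v *: nabla x e2.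
  by rewrite linearDr /= !linearZr_LR.
have combl (u v s t w z : R) :
    s *: (u *: e1 + v *: e2) + t *: (w *: e1 + z *: e2) =
    (s * u + t * w) *: e1 + (s * v + t * z) *: e2.
  by rewrite !scalerDr !scalerA addrACA -!scalerDl.
have combB (u v w z : R) : (u *: e1 + v *: e2) - (w *: e1 + z *: e2) =
    (u - w) *: e1 + (v - z) *: e2.
  by rewrite !scalerBl opprD addrACA.
have [bE rE] : b - p = 0 /\ - a - r = 1.
  apply: (aff_basis_inj e_aff); rewrite scale0r scale1r add0r.
  by rewrite -combB -N12 -N21 nabla_tf e12.
move: fl1 fl2; rewrite e12 N11 N12 N21 N22 !comb N11 N12 N21 N22 !combl !combB.
move=> /(aff_basis_inj e_aff)[F11 F12] /(aff_basis_inj e_aff)[F21 F22].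
have bp : b = p by move/eqP: bE; rewrite subr_eq0 => /eqP.
rewrite bp in F11 F21 *.
have [p0 q0 a_cases] := sl2_bracket_scalars rE F11 F12 F21.
have rE' : r = - 1 - a by rewrite -rE; ring.
exists a, c; split=> //.
- by rewrite p0 scale0r add0r.
- by rewrite p0 scale0r add0r rE'.
- by rewrite p0 q0 oppr0 !scale0r addr0.
Qed.

(** These bases are the images of the given one under the automorphism group. *)
Lemma sheared_basis s k : k != 0 -> aff_basis (e1 + s *: e2) (k *: e2).
Proof.
have [_ e12] := e_aff; move=> k_neq0; apply: aff_basis_intro => //.
  by rewrite scaler_eq0 negb_or k_neq0 (aff_e2_neq0 e_aff).
rewrite linearDl /= linearZr_LR /= e12 linearZl_LR /= linearZr_LR /= liexx.
by rewrite !scaler0 addr0.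
Qed.

Lemma flat_parallel_normal_form :
  sympl_equiv nabla omega (nabla1 e1 e2) (wedge12 e1 e2) \/
  sympl_equiv nabla omega (nabla2 e1 e2) (wedge12 e1 e2).
Proof.
have [a [c [a_cases N11 N12 N21 N22]]] := flat_parallel_coords.
have [alt _ _] := omega_sympl.
have k_neq0 : (omega e1 e2)^-1 != 0 by rewrite invr_eq0 symplectic_neq0.
pose f1 s := e1 + s *: e2; pose f2 := (omega e1 e2)^-1 *: e2.
have f_aff s : aff_basis (f1 s) f2 by exact: sheared_basis.
have omega12 s : omega (f1 s) f2 = 1.
  rewrite /f1 /f2 linearZr_LR /= linearDl /= linearZl_LR /= alt.
  by rewrite mulr0 addr0 [LHS]mulVf // symplectic_neq0.
have F22 : nabla f2 f2 = 0.
  by rewrite /f2 linearZr_LR linearZl_LR /= N22 !scaler0.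
have F12 s : nabla (f1 s) f2 = - a *: f2.
  rewrite /f1 /f2 linearZr_LR /= linearDl /= linearZl_LR /= N12 N22.
  by rewrite scaler0 addr0 !scalerA mulrC.
have F21 s : nabla f2 (f1 s) = (- 1 - a) *: f2.
  rewrite /f1 /f2 linearZl_LR /= linearDr /= linearZr_LR /= N21 N22.
  by rewrite scaler0 addr0 !scalerA mulrC.
have F11 s : nabla (f1 s) (f1 s) = a *: f1 s + (c - (1 + 3 * a) * s) *: e2.
  rewrite /f1 linearDl /= !linearDr /= !linearZr_LR /= !linearZl_LR /=.
  rewrite N11 N12 N21 N22 !scaler0 addr0 !scalerA scalerDr scalerA.
  rewrite -!addrA; congr (_ + _); rewrite -!scalerDl; congr (_ *: _).
  ring.
(* The two values of 1 + 3 a are -2 and -1/2; s is the shear that kills the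
   e2-component of nabla e1 e1. *)
have shear_neq0 : 1 + 3 * a != 0 by case: a_cases => ->; apply/eqP; lra.
pose s := c / (1 + 3 * a).
have {}F11 : nabla (f1 s) (f1 s) = a *: f1 s.
  by rewrite F11 mulrC divfK // subrr scale0r addr0.
have equiv (nabla' : {bilinear h -> h -> h}) :
    nabla' e1 e1 = a *: e1 -> nabla' e1 e2 = - a *: e2 ->
    nabla' e2 e1 = (- 1 - a) *: e2 -> nabla' e2 e2 = 0 ->
  sympl_equiv nabla omega nabla' (wedge12 e1 e2).
  move=> E11 E12 E21 E22; apply: (sympl_equiv_of_table (f_aff s)) => //.
  - by rewrite E11 F11 linearZ /= basis_map1.
  - by rewrite E12 F12 linearZ /= basis_map2.
  - by rewrite E21 F21 linearZ /= basis_map2.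
  - by rewrite E22 F22 linear0.
case: a_cases => a_val; [left|right]; apply: equiv;
  rewrite /nabla1 /nabla2 /= /conn_table !(dual_basisE e_aff) ?a_val.
all: rewrite ?(mulr0, mul0r, mul1r, scale0r, scale1r, addr0, add0r) //.
- by rewrite scaleN1r.
- by rewrite opprK scale1r.
- by rewrite opprK addNr scale0r.
- by rewrite scaleNr.
- by rewrite opprK.
- by rewrite -scaleNr; congr (_ *: _); field.
Qed.

End Classification.

(** * Incompleteness *)

Section Incompleteness.
Variable R : realType.

Lemma is_derive_scalel (W : normedModType R) (f : R -> R) (w : W) t v df :
  is_derive t v f df -> is_derive t v (fun s => f s *: w) (df *: w).
Proof.
move=> [f_der f_val].
have quot : (fun s => s^-1 *: (((fun s => f s *: w) \o shift t) (s *: v) -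
     f t *: w)) @ 0^' --> df *: w.
  have -> : (fun s => s^-1 *: (((fun s => f s *: w) \o shift t) (s *: v) -
      f t *: w)) = fun s => (s^-1 *: ((f \o shift t) (s *: v) - f t)) *: w.
    by apply/funext => s /=; rewrite -scalerBl scalerA.
  by apply: cvgZr_tmp; rewrite -f_val; exact: f_der.
by split; [apply/cvg_ex; exists (df *: w)|exact: cvg_lim].
Qed.

(** A global extension y of the solution x(t) = e / (mu t), t < 0, would be
    continuous at 0, so t y(t) would tend to 0 from the left; but t x(t) is the
    nonzero constant e / mu. *)
Lemma incomplete_of_eigenray (h : lieAlgType R) (nabla : {bilinear h -> h -> h})
    (e : h) (mu : R) :
  e != 0 -> mu != 0 -> nabla e e = mu *: e -> ~ complete_connection nabla.
Proof.
move=> e_neq0 mu_neq0 nabla_e nabla_complete.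
pose x (t : R) := (mu * t)^-1 *: e.
have x_sol : solution_on [set t | t < 0] nabla x.
  move=> t /= t_lt0; have t_neq0 : t != 0 by rewrite lt_eqF.
  have -> : (fun s => rVof (vbasis {:h}) (x s)) =
      (fun s => (mu * s)^-1 *: rVof (vbasis {:h}) e).
    by apply/funext => s; rewrite /x linearZ.
  have -> : - nabla (x t) (x t) = (- (mu * t ^+ 2)^-1) *: e.
    rewrite /x linearZr_LR linearZl_LR /= nabla_e !scalerA -scaleNr.
    by congr (_ *: e); field; rewrite ?mu_neq0 ?t_neq0.
  rewrite linearZ /=; apply: is_derive_scalel.
  have mut_neq0 : mu * t != 0 by rewrite mulf_neq0.
  have lin_der : is_derive t (1 : R) (fun s : R => mu * s) mu.
    by apply: is_derive_eq; rewrite [LHS]mulr1.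
  apply: is_derive_eq (is_deriveV mut_neq0 lin_der) _.
  by rewrite [LHS]mulrC; field; rewrite ?mu_neq0 ?t_neq0.
have [| |y [y_sol yx]] := nabla_complete [set t | t < 0] x _ _ x_sol.
- exact: open_lt.
- by move=> s t /= _ t_lt0 u /andP[_ /le_lt_trans]; apply.
pose z (s : R) := rVof (vbasis {:h}) (y s).
have z_cont : z s @[s --> 0^'-] --> z 0.
  apply: cvg_at_left_filter; apply: differentiable_continuous.
  by apply/derivable1_diffP; case: (y_sol 0 Logic.I).
have lim0 : s *: z s @[s --> 0^'-] --> (0 : 'rV[R]_(\dim {:h})).
  rewrite -(scale0r (z 0)); apply: cvgZ z_cont.
  by apply: cvg_at_left_filter; exact: cvg_id.
have lim1 : s *: z s @[s --> 0^'-] --> mu^-1 *: rVof (vbasis {:h}) e.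
  apply: cvg_near_cst; near=> s.
  have s_lt0 : s < 0 by near: s; exact: nbhs_left_lt.
  have s_neq0 : s != 0 by rewrite lt_eqF.
  rewrite /z yx // /x linearZ /= scalerA; congr (_ *: _).
  by field; rewrite ?mu_neq0 ?s_neq0.
have /eqP : (0 : 'rV[R]_(\dim {:h})) = mu^-1 *: rVof (vbasis {:h}) e.
  by apply: (cvg_unique _ lim0 lim1); exact: norm_hausdorff.
rewrite eq_sym scaler_eq0 invr_eq0 (negPf mu_neq0) rVof_eq0 ?vbasisP //.
by rewrite (negPf e_neq0).
Unshelve. all: by end_near. Qed.

End Incompleteness.

(** * The theorem *)

Theorem proposition4p4 (R : realType) (h : lieAlgType R)
    (h_dim2 : \dim {:h} = 2%N)
    (h_nonabelian : ~ (forall x y : h, lie x y = 0)) :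
  exists e1 e2 : h,
    [/\ aff_basis e1 e2,
        (forall (nabla : {bilinear h -> h -> h}) (omega : {biscalar h}),
          flat nabla -> torsion_free nabla ->
          symplectic_form omega -> parallel nabla omega ->
          sympl_equiv nabla omega (nabla1 e1 e2) (wedge12 e1 e2) \/
          sympl_equiv nabla omega (nabla2 e1 e2) (wedge12 e1 e2)),
        ~ complete_connection (nabla1 e1 e2) &
        ~ complete_connection (nabla2 e1 e2)].
Proof.
have [e1 [e2 e_aff]] := aff_basis_exists h_dim2 h_nonabelian.
have e1_neq0 := aff_e1_neq0 e_aff.
exists e1, e2; split=> //.
- by move=> nabla omega *; apply: flat_parallel_normal_form.
- apply: (incomplete_of_eigenray (mu := -1) e1_neq0).
    by rewrite oppr_eq0 oner_eq0.
  rewrite /= /conn_table !(dual_basisE e_aff) !mulr0 !mul0r mulr1.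
  by rewrite !scale0r !addr0 scale1r scaleN1r.
- apply: (incomplete_of_eigenray (mu := - 2^-1) e1_neq0).
    by rewrite oppr_eq0 invr_eq0 pnatr_eq0.
  rewrite /= /conn_table !(dual_basisE e_aff) !mulr0 !mul0r mulr1.
  by rewrite !scale0r !addr0 scale1r scaleNr.
Qed.
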